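(* Let $\Gamma^j=(G_j,\sigma_j,\mu_j)$ be a $\gamma_j$-regular signed graph on $n_j$ vertices and $m_j$ edges for $j=1,2$, and let $\theta$ be any $r$-orientation of the edges of $\Gamma^1$. Then $$f_{P((\Gamma^1\boxdot\Gamma^2)_\theta)}(\lambda)=\lambda^{m_1-n_1}\prod_{j=1}^{n_2}\Big[\lambda-\frac{\gamma_2}{\gamma_1+\gamma_2}\lambda_j(P(\Gamma^2))\Big]^{n_1}\prod_{j=1}^{n_1}\Big[\lambda^2-\frac{1+\lambda_j(P(\Gamma^1))}{2(n_2+1)}\Big(1+\lambda\gamma_1\Sigma_{A(\Gamma^2)}\big((\gamma_1+\gamma_2)\lambda\big)\Big)\Big],$$ where $\lambda_j(P(\Gamma^i))$ denote the eigenvalues of $P(\Gamma^i)$.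
   Context: A signed graph $\Gamma=(G,\sigma,\mu)$ has a finite simple graph $G$ with vertices $v_1,\dots,v_n$, signature $\sigma:E(G)\to\{\pm1\}$ and marking $\mu:V(G)\to\{\pm1\}$; $\mu(\Gamma)=(\mu(v_1),\dots,\mu(v_n))^T$. $A(\Gamma)$ has $(i,j)$ entry $\sigma(v_iv_j)$ if $v_i\sim v_j$ and $0$ otherwise; $D(\Gamma)$ is the diagonal matrix of (unsigned) degrees; $P(\Gamma)=D(\Gamma)^{-1}A(\Gamma)$ (requires all degrees positive). $\gamma$-regular means all degrees equal $\gamma$. $f_M(\lambda)=\det(\lambda I-M)$. The signed $N$-coronal is the rational function $\Sigma_N(X)=\mu(\Gamma)^T(XI_n-N)^{-1}\mu(\Gamma)$. An $r$-orientation of $(G,\sigma)$ is a map $\theta:V(G)\times E(G)\to\{-1,0,1\}$ with $\theta(w,uv)=0$ for $w\notin\{u,v\}$, $\theta(u,uv)\in\{\pm1\}$ at endpoints, and $\theta(u,uv)\theta(v,uv)=\sigma(uv)$. The subdivision graph $S(\Gamma^1_\theta)$ is obtained by inserting a new vertex $v_e$ into each edge $e$ of $\Gamma^1$, the edge $v_iv_e$ having sign $\theta(v_i,e)$. With $V(\Gamma^1)=\{v_1,\dots,v_{n_1}\}$, the subdivision vertex neighbourhood corona $(\Gamma^1\boxdot\Gamma^2)_\theta$ is obtained from $S(\Gamma^1_\theta)$ and $n_1$ disjoint copies of $\Gamma^2$ by joining, for each $t$, every inserted vertex $v_e$ with $e$ incident to $v_t$ to every vertex $u$ of the $t$-th copy,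 with sign $\theta(v_t,e)\mu_2(u)$, where $\mu_2(u)$ is the marking of the corresponding vertex of $\Gamma^2$. $P$ of the product uses the product's degrees. *)

(* Defs.v *)
From HB Require Import structures.
From mathcomp Require Export all_boot all_order all_algebra.

Set Implicit Arguments.
Unset Strict Implicit.
Unset Printing Implicit Defensive.

Import Order.TTheory GRing.Theory Num.Theory.
Local Open Scope ring_scope.

Definition is_sign (x : int) : bool := (x == 1) || (x == -1).

Lemma is_signM (x y : int) : is_sign x -> is_sign y -> is_sign (x * y).
Proof. by do 2![case/orP=> /eqP->]. Qed.

(* A pair (G, sigma).  The signature is a symmetric function of the two
   endpoints; only its values on adjacent pairs are meaningful. *)
Record sgraph (V : finType) := SGraph {
  adj : rel V;
  sgn : V -> V -> int;
  adj_sym : symmetric adj;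
  adj_irr : irreflexive adj;
  sgn_sym : forall u v, sgn u v = sgn v u;
  sgn_sign : forall u v, adj u v -> is_sign (sgn u v) }.

(* A triple (G, sigma, mu).  Products below are built as [sgraph]s, since
   their adjacency and degree matrices do not involve a marking. *)
Record msgraph (V : finType) := MSGraph {
  sgraph_of :> sgraph V;
  mark : V -> int;
  mark_sign : forall v, is_sign (mark v) }.

Section Graph.
Variables (V : finType) (G : sgraph V).

Definition is_edge (e : {set V}) : bool :=
  [exists u, exists v, adj G u v && (e == [set u; v])].

Definition edge : finType := {e : {set V} | is_edge e}.

Definition deg (v : V) : nat := #|[set w | adj G v w]|.

Definition regular (g : nat) : Prop := forall v, deg v = g.

Record orientation := Orientation {
  orient :> V -> edge -> int;
  orient_out : forall w (e : edge), w \notin val e -> orient w e = 0;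
  orient_end : forall w (e : edge), w \in val e -> is_sign (orient w e);
  orient_sgn : forall u v (e : edge), adj G u v -> val e = [set u; v] ->
    orient u e * orient v e = sgn G u v }.

(* The vertices v_1, ..., v_n are listed in the order of [enum V]. *)
Definition adjmx (F : fieldType) : 'M[F]_#|V| :=
  \matrix_(i, j) if adj G (enum_val i) (enum_val j)
                 then (sgn G (enum_val i) (enum_val j))%:~R else 0.

Definition degmx (F : fieldType) : 'M[F]_#|V| :=
  diag_mx (\row_i (deg (enum_val i))%:R).

Definition Pmx (F : fieldType) : 'M[F]_#|V| := invmx (degmx F) *m adjmx F.

End Graph.

Definition markv (V : finType) (G : msgraph V) (F : fieldType) : 'cV[F]_#|V| :=
  \col_i (mark G (enum_val i))%:~R.

(* The signed N-coronal with its argument taken in the field F.  The rational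
   function of the indeterminate is the case F = {fraction {poly C}}; evaluating
   at another element of that field substitutes it for the indeterminate. *)
Definition coronal (V : finType) (G : msgraph V) (F : fieldType)
    (N : 'M[F]_#|V|) (x : F) : F :=
  ((markv G F)^T *m invmx (x%:M - N) *m markv G F) 0 0.

(* lam lists the eigenvalues of M with algebraic multiplicity. *)
Definition eigenvalues (F : fieldType) n (M : 'M[F]_n) (lam : 'I_n -> F) : Prop :=
  char_poly M = \prod_(j < n) ('X - (lam j)%:P).

Lemma eigenvalues_exist (C : closedFieldType) n (M : 'M[C]_n) :
  exists lam, eigenvalues M lam.
Proof.
have [r def_p] := closed_field_poly_normal (char_poly M).
move: def_p; rewrite (monicP (char_poly_monic M)) scale1r => def_p.
have sz_r : size r = n.
  by apply/eqP; rewrite -eqSS -(size_prod_XsubC r id) -def_p size_char_poly.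
exists (fun j => r`_j); rewrite /eigenvalues def_p (big_nth 0) big_mkord.
by rewrite sz_r.
Qed.

Section Subdivision.
Variables (V : finType) (G : sgraph V) (theta : orientation G).

Definition subdiv_adj (x y : V + edge G) : bool :=
  match x, y with
  | inl v, inr e => v \in val e
  | inr e, inl v => v \in val e
  | _, _ => false
  end.

Definition subdiv_sgn (x y : V + edge G) : int :=
  match x, y with
  | inl v, inr e => theta v e
  | inr e, inl v => theta v e
  | _, _ => 0
  end.

Lemma subdiv_adj_sym : symmetric subdiv_adj.
Proof. by move=> [v|e] [w|f]. Qed.

Lemma subdiv_adj_irr : irreflexive subdiv_adj.
Proof. by case. Qed.

Lemma subdiv_sgn_sym x y : subdiv_sgn x y = subdiv_sgn y x.
Proof. by case: x y => [v|e] [w|f]. Qed.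

Lemma subdiv_sgn_sign x y : subdiv_adj x y -> is_sign (subdiv_sgn x y).
Proof. by case: x y => [v|e] [w|f] //= /orient_end. Qed.

Definition subdiv : sgraph (V + edge G)%type :=
  SGraph subdiv_adj_sym subdiv_adj_irr subdiv_sgn_sym subdiv_sgn_sign.

End Subdivision.

Section Corona.
Variables (V1 V2 : finType) (G1 : sgraph V1) (theta : orientation G1).
Variable G2 : msgraph V2.

(* [inr (t, u)] is the vertex u of the copy of G2 attached to t. *)
Notation vertex := ((V1 + edge G1) + V1 * V2)%type.

Definition svn_adj (x y : vertex) : bool :=
  match x, y with
  | inl a, inl b => adj (subdiv theta) a b
  | inl (inr e), inr (t, _) => t \in val e
  | inr (t, _), inl (inr e) => t \in val e
  | inr (s, u), inr (t, w) => (s == t) && adj G2 u w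
  | _, _ => false
  end.

Definition svn_sgn (x y : vertex) : int :=
  match x, y with
  | inl a, inl b => sgn (subdiv theta) a b
  | inl (inr e), inr (t, u) => theta t e * mark G2 u
  | inr (t, u), inl (inr e) => theta t e * mark G2 u
  | inr (_, u), inr (_, w) => sgn G2 u w
  | _, _ => 0
  end.

Lemma svn_adj_sym : symmetric svn_adj.
Proof.
by move=> [[v|e]|[s u]] [[w|f]|[t w]] //=; rewrite eq_sym adj_sym.
Qed.

Lemma svn_adj_irr : irreflexive svn_adj.
Proof. by move=> [[v|e]|[s u]] //=; rewrite adj_irr andbF. Qed.

Lemma svn_sgn_sym x y : svn_sgn x y = svn_sgn y x.
Proof. by case: x y => [[v|e]|[s u]] [[w|f]|[t w]] //=; rewrite sgn_sym. Qed.

Lemma svn_sgn_sign x y : svn_adj x y -> is_sign (svn_sgn x y).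
Proof.
case: x y => [[v|e]|[s u]] [[w|f]|[t w]] //=.
- exact: orient_end.
- exact: orient_end.
- by move=> te; apply: is_signM (mark_sign G2 w); apply: orient_end.
- by move=> te; apply: is_signM (mark_sign G2 u); apply: orient_end.
- by case/andP=> _; apply: sgn_sign.
Qed.

Definition svn_corona : sgraph vertex :=
  SGraph svn_adj_sym svn_adj_irr svn_sgn_sym svn_sgn_sign.

End Corona.

Notation ratfun C := {fraction {poly C}}.

Definition rconst (C : fieldType) (c : C) : ratfun C := FracField.tofrac c%:P.

Definition rvar (C : fieldType) : ratfun C := FracField.tofrac 'X.

(* Main.v *)
Require Import Defs.
From mathcomp Require Import all_boot all_order all_algebra.
From mathcomp Require Import perm ring mxtens.
Set Implicit Arguments.
Unset Strict Implicit.
Unset Printing Implicit Defensive.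
Import Order.TTheory GRing.Theory Num.Theory.
Local Open Scope ring_scope.

(* Order the vertices of the corona as V1, E(G1), V1 x V2, and let R be the
   vertex-edge incidence matrix of theta, so that R R^T = D + A = g1 (1 + P1).
   With s = g1 + g2, c = 2 (n2 + 1) and U = R^T (x) mu^T, the matrix x - P is
     [     x     -R/g1          0       ]
     [ -R^T/c      x          -U/c      ]
     [     0    -U^T/s   1 (x) (x - A2/s) ].
   Eliminating the last block and then the first one by Schur complements
   leaves x - t R^T R on E(G1), where t = (1/(g1 x) + Sigma_{A2}(s x)) / c, and
   x^n1 det(x - t R^T R) = x^m1 det(x - t R R^T). *)

(** * Determinants: Schur complements, Kronecker products, eigenvalues *)

Lemma det_block_dr (F : fieldType) n m (A : 'M[F]_n) (B : 'M_(n, m))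
    (C : 'M_(m, n)) (D : 'M_m) : D \in unitmx ->
  \det (block_mx A B C D) = \det (A - B *m invmx D *m C) * \det D.
Proof.
move=> uD.
have -> : block_mx A B C D =
    block_mx 1%:M (B *m invmx D) 0 1%:M
    *m block_mx (A - B *m invmx D *m C) 0 C D.
  rewrite mulmx_block !mul1mx ?mul0mx ?mulmx0 ?add0r ?addr0 subrK.
  by rewrite -mulmxA mulVmx // mulmx1.
by rewrite det_mulmx det_ublock det_lblock !det1 !mul1r.
Qed.

Lemma det_block_ul (F : fieldType) n m (A : 'M[F]_n) (B : 'M_(n, m))
    (C : 'M_(m, n)) (D : 'M_m) : A \in unitmx ->
  \det (block_mx A B C D) = \det A * \det (D - C *m invmx A *m B).
Proof.
move=> uA.
have -> : block_mx A B C D =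
    block_mx 1%:M 0 (C *m invmx A) 1%:M
    *m block_mx A B 0 (D - C *m invmx A *m B).
  rewrite mulmx_block !mul1mx ?mul0mx ?mulmx0 ?add0r ?addr0 addrC subrK.
  by rewrite -mulmxA mulVmx // mulmx1.
by rewrite det_mulmx det_ublock det_lblock !det1 !mul1r.
Qed.

(** Both sides are the determinant of one block matrix with rows [x, A] and [x *: B, x], computed by
    eliminating either diagonal block; the extra [x] on [B] cancels the inverse of the eliminated
    block. *)
Lemma det_scalar_sub_mulmxC (F : fieldType) n m (x : F)
    (A : 'M[F]_(n, m)) (B : 'M_(m, n)) : x != 0 ->
  x ^+ n * \det (x%:M - B *m A) = x ^+ m * \det (x%:M - A *m B).
Proof.
move=> x0.
have ux k : (x%:M : 'M_k) \in unitmx.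
  by rewrite unitmxE det_scalar unitfE expf_neq0.
(* A trivial equation, whose two sides are then expanded by different Schur complements. *)
have E : \det (block_mx x%:M A (x *: B) x%:M) =
         \det (block_mx x%:M A (x *: B) x%:M) by [].
rewrite {1}(det_block_ul _ _ _ (ux n)) (det_block_dr _ _ _ (ux m)) in E.
rewrite !det_scalar !invmx_scalar !mul_mx_scalar -!scalemxAl in E.
rewrite -scalemxAr !scalerA mulVf // scale1r in E.
by rewrite E scale1r mulrC.
Qed.

(** Induction on [n]: splitting the identity as [1 + n] makes the product block diagonal, with first
    block [B], up to a cast of the size. *)
Lemma det_tens1mx (R : comNzRingType) n p (B : 'M[R]_p) :
  \det ((1%:M : 'M_n) *t B) = \det B ^+ n.
Proof.
elim: n => [|n IH]; first by rewrite det_mx00.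
have det_cast k l (e : k = l) (e' : k = l) (M : 'M[R]_k) :
    \det (castmx (e, e') M) = \det M.
  by case: _ / e e' => e'; rewrite castmx_id.
rewrite -[n.+1]/(1 + n)%N scalar_mx_block tens_block_mx det_cast.
by rewrite !tens0mx det_ublock IH tens_scalar_mx scale1r det_cast exprS.
Qed.

(** For [q != 0] this is [q ^+ n] times the characteristic polynomial at [y / q], whose
    factorization over [F] is carried to [K] by [f]. The case [q = 0] is separate because of the
    division. *)
Lemma det_scalar_sub_eigen (F K : fieldType) (f : {rmorphism F -> K}) n
    (M : 'M[F]_n) (lam : 'I_n -> F) (y q : K) : eigenvalues M lam ->
  \det (y%:M - q *: map_mx f M) = \prod_(j < n) (y - q * f (lam j)).
Proof.
move=> eM.
have detz z : \det (z%:M - map_mx f M) = \prod_(j < n) (z - f (lam j)).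
  transitivity (char_poly (map_mx f M)).[z].
    rewrite /char_poly -horner_evalE -det_map_mx; congr (\det _).
    apply/matrixP=> i j; rewrite !mxE /= horner_evalE !hornerE.
    by case: (i == j); rewrite ?mulr1n ?mulr0n !hornerE.
  rewrite -map_char_poly eM rmorph_prod horner_prod.
  by apply: eq_bigr => j _; rewrite rmorphB /= map_polyX map_polyC !hornerE.
have [->|q0] := eqVneq q 0.
  rewrite scale0r subr0 det_scalar -[in LHS](card_ord n) -prodr_const.
  by apply: eq_bigr => j _; rewrite mul0r subr0.
have -> : y%:M - q *: map_mx f M = q *: ((y / q)%:M - map_mx f M).
  by rewrite scalerBr scale_scalar_mx mulrCA mulfV // mulr1.
rewrite detZ detz -[in X in X * _](card_ord n) -prodr_const -big_split.
by apply: eq_bigr => j _ /=; rewrite mulrBr mulrCA mulfV // mulr1.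
Qed.

(** * The block determinant for arbitrary [R], [mu] and [B] *)

Section CoronaBlock.
Variables (F : fieldType) (n m p : nat).
Variables (R : 'M[F]_(n, m)) (mu : 'cV[F]_p).

(* The matrix [R^T *t mu^T], with row type ['I_m] instead of ['I_(m * 1)]. *)
Definition tens_col : 'M[F]_(m, n * p) :=
  \matrix_(e, k) (R (mxtens_unindex k).1 e * mu (mxtens_unindex k).2 0).

(** By the mixed product rule the left side is the Kronecker product of [R^T *m R] with the 1 by 1
    matrix [mu^T *m B *m mu], that is, a scalar multiple. *)
Lemma tens_col_quadratic (B : 'M[F]_p) :
  tens_col *m (1%:M *t B) *m tens_col^T = (mu^T *m B *m mu) 0 0 *: (R^T *m R).
Proof.
have sumE (f : 'I_(n * p) -> F) :
    \sum_k f k = \sum_i \sum_j f (mxtens_index (i, j)).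
  rewrite pair_bigA (reindex (@mxtens_index n p)) /=.
    by apply: eq_bigr => -[].
  by exists (@mxtens_unindex n p) => k _; rewrite (mxtens_indexK, mxtens_unindexK).
apply/matrixP=> e f; rewrite !mxE sumE mulr_sumr; apply: eq_bigr => i _.
rewrite mulr_suml; apply: eq_bigr => j _.
rewrite !mxE sumE mxtens_indexK /= (bigD1 i) //= [X in _ + X]big1 ?addr0.
  rewrite !mulr_suml; apply: eq_bigr => l _.
  by rewrite !mxE !mxtens_indexK /= eqxx mul1r; ring.
move=> k ki; apply: big1 => l _.
by rewrite !mxE !mxtens_indexK /= (negbTE ki) mul0r mulr0.
Qed.

(** For the corona, [a], [b], [c] are the reciprocals of the degrees of old, copy and inserted
    vertices. *)
Lemma det_corona_block (x a b c : F) (B : 'M[F]_p) :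
  x != 0 -> B \in unitmx ->
  x ^+ n * \det (block_mx
     (block_mx x%:M (- a *: R) (- c *: R^T) x%:M) (col_mx 0 (- c *: tens_col))
     (row_mx 0 (- b *: tens_col^T)) (1%:M *t B))
  = x ^+ m * \det B ^+ n
    * \det ((x ^+ 2)%:M - c * (a + x * b * (mu^T *m invmx B *m mu) 0 0)
               *: (R *m R^T)).
Proof.
move=> x0 uB.
have ux k : (x%:M : 'M_k) \in unitmx.
  by rewrite unitmxE det_scalar unitfE expf_neq0.
have tens11 : (1%:M : 'M[F]_n) *t (1%:M : 'M_p) = 1%:M.
  apply/matrixP=> i j; case: (mxtens_indexP i) => i0 i1.
  case: (mxtens_indexP j) => j0 j1; rewrite tensmxE !mxE.
  by rewrite (can_eq (@mxtens_indexK n p)) xpair_eqE -natrM mulnb.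
have invW : (1%:M : 'M[F]_n) *t B *m (1%:M *t invmx B) = 1%:M.
  by rewrite tensmx_mul mul1mx mulmxV.
have uW : (1%:M : 'M[F]_n) *t B \in unitmx by case/mulmx1_unit: invW.
have {invW} invW : invmx ((1%:M : 'M[F]_n) *t B) = 1%:M *t invmx B.
  by rewrite -[LHS]mulmx1 -invW mulmxA mulVmx // mul1mx.
rewrite det_block_dr // det_tens1mx invW mul_col_mx mul0mx mul_col_row.
rewrite !mul0mx mulmx0 -!scalemxAl -scalemxAr tens_col_quadratic !scalerA.
set k := (_ *m mu) 0 0; rewrite opp_block_mx add_block_mx !subr0.
rewrite det_block_ul // invmx_scalar mul_mx_scalar -!scalemxAl -scalemxAr.
rewrite !scalerA det_scalar -addrA -opprD -scalerDl.
(* [t] is [c * b * k] from eliminating the copies plus [c * a / x] from eliminating the old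
   vertices. *)
set t := (X in X *: (R^T *m R)).
have := det_scalar_sub_mulmxC (t *: R) R^T x0.
rewrite -scalemxAr -scalemxAl => E; rewrite mulrAC mulrCA E.
(* Of the two factors [x ^+ n], one was spent on exchanging [R^T *m R] for [R *m R^T]; the other is
   absorbed into this determinant of size [n]. *)
have -> : (x ^+ 2)%:M - c * (a + x * b * k) *: (R *m R^T)
          = x *: (x%:M - t *: (R *m R^T)).
  rewrite scalerBr scale_scalar_mx scalerA; congr (_%:M - _ *: _).
  by rewrite /t; field.
by rewrite detZ; ring.
Qed.
End CoronaBlock.

(** The two orderings of [T] differ by a permutation applied to rows and columns alike, so its sign
    enters squared. *)
Lemma det_reindex (R : comNzRingType) (T : finType) n (h : 'I_n -> T)
    (M : 'M[R]_#|T|) : bijective h ->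
  \det M = \det (\matrix_(i, j) M (enum_rank (h i)) (enum_rank (h j))).
Proof.
move=> bij_h; have bij_s : bijective (enum_rank \o h).
  exact: bij_comp (@enum_rank_bij T) bij_h.
rewrite -[X in _ = \det X]/(\matrix_(i, j) M ((enum_rank \o h) i)
  ((enum_rank \o h) j)).
move: (enum_rank \o h) bij_s => s bij_s {h bij_h}.
have eN : n = #|T| by rewrite -(card_ord n) (bij_eq_card bij_s) card_ord.
(* Generalizing [#|T|] lets the two sizes be identified, so that [s] becomes a permutation of
   ['I_n]. *)
move: #|T| eN M s bij_s => N eN; case: _ / eN => M s bij_s.
set p := perm (bij_inj bij_s).
have -> : \matrix_(i, j) M (s i) (s j) = row_perm p (col_perm p M).
  by apply/matrixP=> i j; rewrite !mxE !permE.
rewrite row_permE col_permE !det_mulmx !det_perm odd_permV.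
by rewrite mulrCA -signr_addb addbb mulr1.
Qed.

(** * Adjacency, degree and incidence matrices of a signed graph *)

Section GraphMatrices.
Variables (V : finType) (G : sgraph V).

Lemma map_adjmx (F K : fieldType) (f : {rmorphism F -> K}) :
  map_mx f (adjmx G F) = adjmx G K.
Proof.
by apply/matrixP=> i j; rewrite !mxE; case: ifP; rewrite (rmorph_int, rmorph0).
Qed.

Lemma map_Pmx (F K : fieldType) (f : {rmorphism F -> K}) :
  map_mx f (Pmx G F) = Pmx G K.
Proof.
rewrite /Pmx map_mxM map_invmx map_diag_mx map_adjmx.
congr (invmx (diag_mx _) *m _).
by apply/rowP=> i; rewrite !mxE rmorph_nat.
Qed.

Lemma PmxE (F : fieldType) i j : (forall v, (deg G v)%:R != 0 :> F) ->
  Pmx G F i j = (deg G (enum_val i))%:R^-1 * adjmx G F i j.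
Proof.
move=> deg0; pose d : 'rV[F]_#|V| := \row_i (deg G (enum_val i))%:R^-1.
have dD : diag_mx d *m degmx G F = 1%:M.
  rewrite mulmx_diag; apply/matrixP=> k l; rewrite !mxE.
  by rewrite mulVf ?deg0.
have uD : degmx G F \in unitmx by case/mulmx1_unit: dD.
have -> : Pmx G F = diag_mx d *m adjmx G F.
  by rewrite /Pmx -[diag_mx d](mulmxK uD) dD mul1mx.
by rewrite mul_diag_mx !mxE.
Qed.

Lemma Pmx_regular (F : fieldType) g : regular G g -> g%:R != 0 :> F ->
  Pmx G F = g%:R^-1 *: adjmx G F.
Proof.
move=> regG g0; apply/matrixP=> i j; rewrite PmxE ?regG ?mxE //.
by move=> v; rewrite regG.
Qed.

Lemma edgeP (e : edge G) : exists u v, adj G u v /\ val e = [set u; v].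
Proof.
case/existsP: (valP e) => u /existsP[v /andP[uv /eqP E]].
by exists u, v.
Qed.

Lemma adj_neq u v : adj G u v -> u != v.
Proof. by apply: contraTneq => ->; rewrite adj_irr. Qed.

Lemma card_edge_ends (e : edge G) : #|val e| = 2%N.
Proof.
by have [u [v [/adj_neq uv ->]]] := edgeP e; rewrite cards2 uv.
Qed.

Lemma edge_of_adj u v : adj G u v -> {e : edge G | val e = [set u; v]}.
Proof.
move=> uv; suff E : is_edge G [set u; v] by exists (Sub [set u; v] E); rewrite SubK.
by apply/existsP; exists u; apply/existsP; exists v; rewrite uv eqxx.
Qed.

(** Sending a neighbour [w] to [[set v; w]] is a bijection onto the edges at [v]. *)
Lemma card_incident v : #|[set e : edge G | v \in val e]| = deg G v.
Proof.
rewrite -(card_imset _ val_inj) /deg.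
rewrite -(@card_in_imset _ _ (fun w => [set v; w]) [set w | adj G v w]).
  apply: eq_card => A; apply/imsetP/imsetP => [[e]|[w]]; rewrite inE.
    have [u [w [uw eE]]] := edgeP e; rewrite eE !inE => /orP[]/eqP-> ->.
      by exists w; rewrite // inE.
    by exists u; rewrite ?eE 1?setUC // inE adj_sym.
  by case/edge_of_adj=> e eE ->; exists e; rewrite // inE eE set21.
move=> w w'; rewrite !inE => /adj_neq vw _ /setP/(_ w).
by rewrite !inE eqxx orbT eq_sym (negbTE vw) => /esym/eqP.
Qed.

End GraphMatrices.

Section Incidence.
Variables (V : finType) (G : sgraph V) (theta : orientation G).

Definition incmx (F : fieldType) : 'M[F]_(#|V|, #|edge G|) :=
  \matrix_(i, e) (theta (enum_val i) (enum_val e))%:~R.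

(** On the diagonal each incident edge contributes the square of a sign. Off the diagonal only an
    edge joining the two vertices can contribute; it is unique, and the orientation axiom makes its
    term the signature. *)
Lemma incmx_mul_tr (F : fieldType) :
  incmx F *m (incmx F)^T = degmx G F + adjmx G F.
Proof.
apply/matrixP=> i j; rewrite !mxE.
set u := enum_val i; set v := enum_val j.
transitivity ((\sum_(e : edge G) theta u e * theta v e)%:~R : F).
  rewrite rmorph_sum (reindex (@enum_val _ (edge G))) /=.
    by apply: eq_bigr => e _; rewrite !mxE intrM.
  exact/onW_bij/enum_val_bij.
have [ij|ij] := eqVneq i j.
  rewrite /v -ij -/u adj_irr addr0 mulr1n -card_incident -sum1dep_card.
  rewrite (bigID (fun e : edge G => u \in val e)) /= [X in _ + X]big1.
    rewrite addr0 (eq_bigr (fun=> 1)) => [|e /(orient_end theta)].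
      by rewrite natr_sum rmorph_sum.
    by case/orP=> /eqP->.
  by move=> e /orient_out->; rewrite mul0r.
have uv : u != v by apply: contra_neq ij => /enum_val_inj.
rewrite mulr0n add0r.
have dich (e : edge G) : u \in val e -> v \in val e ->
    adj G u v /\ val e = [set u; v].
  have [a [b [ab ->]]] := edgeP e; rewrite !inE.
  case/orP=> /eqP ua; case/orP=> /eqP vb.
  - by rewrite ua vb eqxx in uv.
  - by rewrite ua vb.
  - by rewrite ua vb adj_sym setUC.
  - by rewrite ua vb eqxx in uv.
have out (e : edge G) : ~~ ((u \in val e) && (v \in val e)) ->
    theta u e * theta v e = 0.
  by case/nandP=> /orient_out->; rewrite (mul0r, mulr0).
case: ifP => [auv|nuv].
  have [e eE] := edge_of_adj auv.
  rewrite (bigD1 e) //= big1 ?addr0 ?(orient_sgn theta auv eE) // => f fe.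
  apply: out; apply: contra fe => /andP[uf vf].
  by apply/eqP/val_inj; rewrite eE; have [] := dich f uf vf.
rewrite big1 // => e _; apply: out; apply/negP => /andP[ue ve].
by have [] := dich e ue ve; rewrite nuv.
Qed.

End Incidence.

(** * The matrix P of the corona and its determinant *)

Section CoronaMatrix.
Variables (V1 V2 : finType) (G1 : sgraph V1) (theta : orientation G1).
Variables (G2 : msgraph V2) (g1 g2 : nat).
Hypotheses (reg1 : regular G1 g1) (reg2 : regular G2 g2).
Local Notation G := (svn_corona theta G2).
Local Notation n1 := #|V1|.
Local Notation n2 := #|V2|.
Local Notation m1 := #|edge G1|.

Lemma deg_corona_old v : deg G (inl (inl v)) = g1.
Proof.
rewrite -(reg1 v) -(card_incident G1 v) /deg -!sum1dep_card !big_sumType /=.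
by rewrite !big_pred0_eq addn0.
Qed.

(** Each of the two ends of [e] contributes itself and the [n2] vertices of its copy. *)
Lemma deg_corona_new e : deg G (inl (inr e)) = (2 * (n2 + 1))%N.
Proof.
rewrite /deg -sum1dep_card !big_sumType /= big_pred0_eq addn0.
rewrite [X in (_ + X)%N](eq_bigl (fun p => (p.1 \in val e) && predT p.2)).
  rewrite -(pair_big (fun t => t \in val e) predT (fun _ _ => 1%N)) /=.
  rewrite !sum1_card sum_nat_const card_edge_ends; ring.
by case=> t u; rewrite andbT.
Qed.

Lemma deg_corona_copy t u : deg G (inr (t, u)) = (g1 + g2)%N.
Proof.
rewrite -(reg1 t) -(reg2 u) -(card_incident G1 t) /deg -!sum1dep_card !big_sumType /=.
rewrite big_pred0_eq add0n; congr (_ + _)%N.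
rewrite (eq_bigl (fun p => (p.1 == t) && adj G2 u p.2)).
  by rewrite -(pair_big (pred1 t) (adj G2 u) (fun _ _ => 1%N)) big_pred1_eq.
by case=> s w; rewrite /= eq_sym.
Qed.

(** Pairs are decoded as in [*t], so that the block of the copies is literally a Kronecker product
    with the identity. *)
Definition corona_vertex (k : 'I_((n1 + m1) + n1 * n2)) :
    (V1 + edge G1) + V1 * V2 :=
  match split k with
  | inl a => inl match split a with
                 | inl i => inl (enum_val i)
                 | inr e => inr (enum_val e)
                 end
  | inr b => inr (enum_val (mxtens_unindex b).1, enum_val (mxtens_unindex b).2)
  end.

Lemma corona_vertex_bij : bijective corona_vertex.
Proof.
pose f (y : (V1 + edge G1) + V1 * V2) : 'I_((n1 + m1) + n1 * n2) :=
  match y with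
  | inl (inl v) => lshift _ (lshift _ (enum_rank v))
  | inl (inr e) => lshift _ (rshift _ (enum_rank e))
  | inr (t, u) => rshift _ (mxtens_index (enum_rank t, enum_rank u))
  end.
exists f => [k|[[v|e]|[t u]]]; rewrite /corona_vertex /f.
- case: (split_ordP k) => [a|b] ->.
    by case: (split_ordP a) => [i|e] ->; rewrite enum_valK.
  by case: (mxtens_indexP b) => t u; rewrite mxtens_indexK /= !enum_valK.
- by rewrite !(unsplitK (inl _)) enum_rankK.
- by rewrite (unsplitK (inl _)) (unsplitK (inr _)) enum_rankK.
- by rewrite (unsplitK (inr _)) mxtens_indexK !enum_rankK.
Qed.

Lemma corona_Pmx_block (F : fieldType) :
  g1%:R != 0 :> F -> (g1 + g2)%:R != 0 :> F -> (2 * (n2 + 1))%:R != 0 :> F ->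
  let R := incmx theta F in
  let U := tens_col R (markv G2 F) in
  let c := (2 * (n2 + 1))%:R^-1 in
  \matrix_(i, j) Pmx G F (enum_rank (corona_vertex i))
                         (enum_rank (corona_vertex j))
  = block_mx (block_mx 0 (g1%:R^-1 *: R) (c *: R^T) 0)
             (col_mx 0 (c *: U)) (row_mx 0 ((g1 + g2)%:R^-1 *: U^T))
             (1%:M *t ((g1 + g2)%:R^-1 *: adjmx G2 F)).
Proof.
move=> h1 h12 hc R U c.
have deg0 v : (deg G v)%:R != 0 :> F.
  case: v => [[v|e]|[t u]]; first by rewrite deg_corona_old.
    by rewrite deg_corona_new.
  by rewrite deg_corona_copy.
have thetaE v (e : edge G1) : (if v \in val e then (theta v e)%:~R else 0)
    = (theta v e)%:~R :> F.
  by case: ifPn => // /orient_out->.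
apply/matrixP=> i j; rewrite mxE PmxE // [adjmx _ _ _ _]mxE !enum_rankK.
rewrite /corona_vertex.
case: (split_ordP i) => [a|b] ->; case: (split_ordP j) => [a'|b'] -> /=.
- rewrite block_mxEul; case: (split_ordP a) => [k|e] ->;
    case: (split_ordP a') => [k'|e'] -> /=.
  + by rewrite block_mxEul !mxE mulr0.
  + by rewrite block_mxEur deg_corona_old thetaE !mxE.
  + by rewrite block_mxEdl deg_corona_new thetaE !mxE.
  + by rewrite block_mxEdr !mxE mulr0.
- rewrite block_mxEur; case: (split_ordP a) => [k|e] -> /=.
  + by rewrite col_mxEu !mxE mulr0.
  + rewrite col_mxEd deg_corona_new !mxE -intrM; congr (_ * _).
    by case: ifPn => // /orient_out->; rewrite mul0r.
- rewrite block_mxEdl; case: (split_ordP a') => [k|e] -> /=.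
  + by rewrite row_mxEl !mxE mulr0.
  + rewrite row_mxEr deg_corona_copy !mxE -intrM; congr (_ * _).
    by case: ifPn => // /orient_out->; rewrite mul0r.
- rewrite block_mxEdr deg_corona_copy !mxE (inj_eq enum_val_inj).
  by case: (_ == _); rewrite /= ?mulr0 ?mul0r ?mul1r.
Qed.

Lemma det_corona (F : fieldType) (x : F) :
  g1%:R != 0 :> F -> (g1 + g2)%:R != 0 :> F -> (2 * (n2 + 1))%:R != 0 :> F ->
  x != 0 -> let B := x%:M - (g1 + g2)%:R^-1 *: adjmx G2 F in
  B \in unitmx ->
  x ^+ n1 * \det (x%:M - Pmx G F) =
  x ^+ m1 * \det B ^+ n1
    * \det ((x ^+ 2)%:M - (2 * (n2 + 1))%:R^-1
         * (1 + x * g1%:R * coronal G2 (adjmx G2 F) ((g1 + g2)%:R * x))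
         *: (1%:M + Pmx G1 F)).
Proof.
move=> h1 h12 hc x0 B uB.
rewrite (det_reindex _ corona_vertex_bij).
have -> : \matrix_(i, j) (x%:M - Pmx G F) (enum_rank (corona_vertex i))
                         (enum_rank (corona_vertex j))
  = x%:M - \matrix_(i, j) Pmx G F (enum_rank (corona_vertex i))
                         (enum_rank (corona_vertex j)).
  apply/matrixP=> i j; rewrite !mxE; congr (x *+ (_ : bool) - _).
  by rewrite (inj_eq enum_rank_inj) (inj_eq (bij_inj corona_vertex_bij)).
rewrite corona_Pmx_block // !scalar_mx_block !opp_block_mx !add_block_mx.
rewrite !sub0r !subr0 opp_col_mx opp_row_mx !oppr0 -!scaleNr.
have -> : x%:M - (1%:M : 'M_n1) *t ((g1 + g2)%:R^-1 *: adjmx G2 F) = (1%:M : 'M_n1) *t B.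
  apply/matrixP=> i j; case: (mxtens_indexP i) => i0 i1.
  case: (mxtens_indexP j) => j0 j1; rewrite !mxE !mxtens_indexK /=.
  rewrite (can_eq (@mxtens_indexK n1 n2)) xpair_eqE.
  by case: (i0 == j0); rewrite /= ?mul0r ?mul1r ?subr0.
rewrite det_corona_block //; congr (_ * _).
congr determinant; rewrite [in RHS]scaleNr; congr (_ - _).
rewrite incmx_mul_tr (Pmx_regular reg1 h1).
(* Regularity turns D + A into [g1] times [1 + P]; this [g1] cancels the reciprocal degree of the
   old vertices. *)
have -> : degmx G1 F = g1%:R *: 1%:M.
  rewrite scalemx1; apply/matrixP=> i j; rewrite !mxE.
  by rewrite reg1.
have -> : g1%:R *: 1%:M + adjmx G1 F
    = g1%:R *: (1%:M + g1%:R^-1 *: adjmx G1 F).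
  by rewrite scalerDr scalerA mulfV // scale1r.
rewrite scalerA -mulrA; congr (_ * _ *: _).
rewrite /coronal.
(* Hence the coronal at [(g1 + g2)%:R * x] is the quadratic form of [invmx B] divided by
   [g1 + g2]. *)
have -> : ((g1 + g2)%:R * x)%:M - adjmx G2 F = (g1 + g2)%:R *: B.
  by rewrite scalerBr scale_scalar_mx scalerA mulfV // scale1r.
rewrite invmxZ ?unitmxZ ?unitfE // -scalemxAr -scalemxAl [in RHS]mxE mulrDl mulVf //.
by ring.
Qed.

End CoronaMatrix.

(** * Specialization to the field of rational functions *)

Theorem theorem6p7 (C : numClosedFieldType) (V1 V2 : finType)
    (G1 : msgraph V1) (G2 : msgraph V2) (g1 g2 : nat)
    (theta : orientation G1)
    (lam1 : 'I_#|V1| -> C) (lam2 : 'I_#|V2| -> C) :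
  (0 < g1)%N -> (0 < g2)%N ->
  regular G1 g1 -> regular G2 g2 ->
  eigenvalues (Pmx G1 C) lam1 -> eigenvalues (Pmx G2 C) lam2 ->
  let n1 := #|V1| in
  let n2 := #|V2| in
  let m1 := #|edge G1| in
  let x : ratfun C := rvar C in
  FracField.tofrac (char_poly (Pmx (svn_corona theta G2) C)) =
    x ^ (m1%:Z - n1%:Z)
    * \prod_(j < n2) (x - g2%:R / (g1 + g2)%:R * rconst (lam2 j)) ^+ n1
    * \prod_(j < n1)
        (x ^+ 2 - (1 + rconst (lam1 j)) / (2 * (n2 + 1))%:R
           * (1 + x * g1%:R
                * coronal G2 (adjmx G2 (ratfun C)) ((g1 + g2)%:R * x))).
Proof.
move=> g1_gt0 g2_gt0 reg1 reg2 eig1 eig2 n1 n2 m1 x.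
pose f : {rmorphism C -> ratfun C} := @FracField.tofrac {poly C} \o polyC.
have fE c : rconst c = f c by [].
have nat0 k : (0 < k)%N -> k%:R != 0 :> ratfun C.
  by move=> k0; rewrite -(rmorph_nat f) fmorph_eq0 pnatr_eq0 -lt0n.
have x0 : x != 0 by rewrite /x /rvar tofrac_eq0 polyX_eq0.
(* Characteristic polynomials become determinants over a field, where [x] and the blocks can be
   inverted. *)
have charE n (M : 'M[C]_n) :
    FracField.tofrac (char_poly M) = \det (x%:M - map_mx f M).
  rewrite /char_poly -det_map_mx; congr (\det _); apply/matrixP=> i j.
  by rewrite !mxE rmorphB /= rmorphMn.
set s : ratfun C := (g1 + g2)%:R.
have s0 : s != 0 by rewrite nat0 // addn_gt0 g1_gt0.
(* By regularity [A2 / s] equals [g2 / s] times [P2]. *)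
have detB : \det (x%:M - s^-1 *: adjmx G2 (ratfun C))
    = \prod_(j < n2) (x - g2%:R / s * rconst (lam2 j)).
  rewrite -(det_scalar_sub_eigen f _ _ eig2) map_Pmx.
  rewrite (Pmx_regular reg2 (nat0 _ g2_gt0)) scalerA mulrAC mulfV ?nat0 //.
  by rewrite mul1r.
(* The determinant is a characteristic polynomial over [C], which is monic and thus nonzero. *)
have uB : x%:M - s^-1 *: adjmx G2 (ratfun C) \in unitmx.
  rewrite unitmxE unitfE.
  have -> : s^-1 *: adjmx G2 (ratfun C)
      = map_mx f ((g1 + g2)%:R^-1 *: adjmx G2 C).
    by rewrite map_mxZ map_adjmx fmorphV rmorph_nat.
  by rewrite -charE tofrac_eq0 monic_neq0 // char_poly_monic.
(* Multiplying by [x ^+ n1] clears the possibly negative exponent [m1 - n1]. *)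
apply: (mulfI (expf_neq0 n1 x0)).
rewrite charE map_Pmx (det_corona theta reg1 reg2) ?nat0 ?addn_gt0 ?g1_gt0 //;
  last by rewrite orbT.
rewrite -/s detB -/n2 -/x; set k := 1 + _.
set q := _^-1 * k.
(* Moving the identity into the scalar part gives the form [y - q P1], whose determinant is known
   from the eigenvalues. *)
have -> : (x ^+ 2)%:M - q *: (1%:M + Pmx G1 (ratfun C))
    = (x ^+ 2 - q)%:M - q *: map_mx f (Pmx G1 C).
  by rewrite map_Pmx scalerDr scalemx1 opprD addrA raddfB.
rewrite (det_scalar_sub_eigen f _ _ eig1) prodrXl !mulrA; congr (_ * _ * _).
  by rewrite [in RHS](exprnP x n1) -expfzDr // addrC subrK.
by apply: eq_bigr => j _; rewrite /q fE -/k; ring.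
Qed.
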